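(* Let $n\geq 2$ be an integer, let $b:=-n+i$, let $D\subset\{0,1,\ldots,n^{2}\}$ and put $\Delta:=D-D=\{d-d': d,d'\in D\}$. Suppose one of the following holds: (i) $n\geq 2$, $D\subset\{0,1,\ldots,\lfloor n^{2}/2\rfloor\}$, and $|\delta-\delta'|\neq 1$ for all $\delta,\delta'\in\Delta$; (ii) $n\geq 5$ and $|\delta-\delta'|>2$ for all $\delta\neq\delta'$ in $\Delta$; (iii) $n\in\{2,3,4\}$ and $|\delta-\delta'|>3$ for all $\delta\neq\delta'$ in $\Delta$. Then the level sets of $\Phi_{n,D}$ are dense in $F_{n,D}$; that is, for every $\lambda\in[0,\dim_{B}C_{n,D}]$ the set $\Phi_{n,D}^{-1}(\{\lambda\})$ is dense in $F_{n,D}$.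
   Context: $C_{n,D}$ denotes the attractor of the iterated function system $\{f_{d}(z)=b^{-1}(z+d): d\in D\}$ on $\mathbb{C}$, i.e. the unique nonempty compact set with $C_{n,D}=\bigcup_{d\in D}f_d(C_{n,D})$; equivalently $C_{n,D}=\{\sum_{j\ge1}d_jb^{-j}: d_j\in D\}$. For $\alpha\in\mathbb{C}$ let $C(\alpha):=C_{n,D}\cap(C_{n,D}+\alpha)$. $F_{n,D}:=\{\alpha\in\mathbb{C}: C(\alpha)\neq\emptyset\}$. $\dim_B$ denotes box-counting dimension (the common value of the upper and lower box-counting dimensions, when they agree). $\Phi_{n,D}$ is the function defined on $\{\alpha\in F_{n,D}: \dim_B C(\alpha)\text{ exists}\}$ with values in $[0,\dim_B C_{n,D}]$ given by $\Phi_{n,D}(\alpha)=\dim_B C(\alpha)$. *)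

(* Defs.v *)
From Stdlib Require Import Reals ZArith.
From Coquelicot Require Import Coquelicot.
Open Scope R_scope.

Definition base (n : nat) : C := (- INR n, 1)%R.

Definition attractor (n : nat) (D : nat -> Prop) : C -> Prop :=
  fun z => exists dig : nat -> nat,
    (forall j, D (dig j)) /\
    is_series (V := C_NormedModule)
      (fun j : nat => Cmult (RtoC (INR (dig j))) (Cinv (Cpow (base n) (S j)))) z.

Definition inter_set (n : nat) (D : nat -> Prop) (alpha : C) : C -> Prop :=
  fun z => attractor n D z /\ attractor n D (Cminus z alpha).

Definition Fset (n : nat) (D : nat -> Prop) : C -> Prop :=
  fun alpha => exists z, inter_set n D alpha z.

Definition covered_by (A : C -> Prop) (delta : R) (k : nat) : Prop :=
  exists c : nat -> C, forall z, A z -> exists i, (i < k)%nat /\ Cmod (Cminus z (c i)) <= delta.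

Definition min_cover (A : C -> Prop) (delta : R) (k : nat) : Prop :=
  covered_by A delta k /\ forall m, covered_by A delta m -> (k <= m)%nat.

Definition has_box_dim (A : C -> Prop) (s : R) : Prop :=
  (forall delta, 0 < delta -> exists k, covered_by A delta k) /\
  forall eps, 0 < eps -> exists delta0, 0 < delta0 /\
    forall delta k, 0 < delta < delta0 -> min_cover A delta k ->
      Rabs (ln (INR k) / (- ln delta) - s) < eps.

Definition Phi_eq (n : nat) (D : nat -> Prop) (alpha : C) (lambda : R) : Prop :=
  Fset n D alpha /\ has_box_dim (inter_set n D alpha) lambda.

Definition diffset (D : nat -> Prop) (x : Z) : Prop :=
  exists d d', D d /\ D d' /\ x = (Z.of_nat d - Z.of_nat d')%Z.

(* Main.v *)
Require Import Defs.
From Stdlib Require Import Reals ZArith List Lra Lia Classical ClassicalEpsilon.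
From Stdlib Require Import FunctionalExtensionality PropExtensionality.
From Coquelicot Require Import Coquelicot.
Open Scope R_scope.

(** Every [alpha] in [F] is a series [sum delta_j b^-j] with [delta_j] in [D - D].
    Such expansions are unique: if [sum e_j b^-j = 0] with [e_j] in the second
    difference set, the imaginary parts [y_k] of the Gaussian integers
    [sum_(j<=k) e_j b^(k-j)] are a bounded integer solution of
    [y_(k+2) + 2n y_(k+1) + (n^2+1) y_k = e_k], and looking at a few terms from where
    [|y|] is maximal bounds it below the smallest nonzero [|e_j|]. Hence [C(alpha)] is
    the set of series whose [j]-th digit lies in the intersection of [D] with
    [D + delta_j], and its box dimension is the growth rate of the products of the sizes
    of these intersections, divided by [ln |b|].

    Given [lambda = t s], keep the first [J] digits of [alpha] and continue with [0]
    (intersection of size [|D|]) when the integer part of [k t] jumps at [k], and with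
    [max D - min D] (intersection of size 1) otherwise. *)

(** * Bounded integer solutions of the recurrence with characteristic polynomial
    [X^2 + 2 n X + n^2 + 1] *)

Open Scope Z_scope.

(* With [m] read as the largest absolute value of a bounded solution [y] of
   [y (k+2) + 2 n y (k+1) + (n^2+1) y k = e k], attained at its first argument:
   no such solution has maximum above [thr] when [|e| <= E]. *)
Definition excludes_max (n E thr : Z) : Prop :=
  forall m y1 y2 y3 y4 e0 e1 e2 : Z, thr < m ->
  y2 + 2 * n * y1 + (n * n + 1) * m = e0 ->
  y3 + 2 * n * y2 + (n * n + 1) * y1 = e1 ->
  y4 + 2 * n * y3 + (n * n + 1) * y2 = e2 ->
  Z.abs e0 <= E -> Z.abs e1 <= E -> Z.abs e2 <= E ->
  Z.abs y1 <= m -> Z.abs y2 <= m -> Z.abs y3 <= m -> Z.abs y4 <= m -> False.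

(** The relation for [e0] gives [-2 y1 >= n (m - 1)], which forces [m <= 3] and [y1 = - m]; the
    relation for [e1] gives [y2 = m] in the same way. Then the first one yields
    [m ((n - 1)^2 + 1) <= n^2], false for [m >= 2] and [n >= 3]. *)
Lemma excludes_max_half (n : Z) : 3 <= n -> excludes_max n (n * n) 1.
Proof.
  intros Hn m y1 y2 y3 y4 e0 e1 e2 Hm R0 R1 _ E0 E1 _ B1 B2 B3 _.
  rewrite Z.abs_le in *.
  assert (A1 : n * (m - 1) <= - 2 * y1) by (apply (Z.mul_le_mono_pos_l _ _ n); lia).
  assert (Hm3 : m <= 3) by nia.
  assert (y1 = - m) by nia. subst y1.
  assert (A2 : n * (m - 1) <= 2 * y2) by (apply (Z.mul_le_mono_pos_l _ _ n); lia).
  assert (y2 = m) by nia. subst y2.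
  assert (m = 2 \/ m = 3) as [-> | ->] by lia; nia.
Qed.

(** The same alternation of signs: [m = 3], [y1 = - 3], [y2 = 3], and the first relation becomes
    [n^2 - 6 n + 6 <= 0], which fails from [n = 5] on. *)
Lemma excludes_max_full (n : Z) : 5 <= n -> excludes_max n (2 * (n * n)) 2.
Proof.
  intros Hn m y1 y2 y3 y4 e0 e1 e2 Hm R0 R1 _ E0 E1 _ B1 B2 B3 _.
  rewrite Z.abs_le in *.
  assert (A1 : n * (m - 2) <= - 2 * y1) by (apply (Z.mul_le_mono_pos_l _ _ n); lia).
  assert (m = 3) by nia. subst m.
  assert (y1 = - 3) by lia. subst y1.
  assert (A2 : n * 1 <= 2 * y2) by (apply (Z.mul_le_mono_pos_l _ _ n); lia).
  assert (y2 = 3) by lia. subst y2. nia.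
Qed.

(** Once [m >= 4], the relation for [e0] leaves [y2] smaller than the relation for [e1] allows. The
    threshold 3 matches the larger gap assumed for small [n]. *)
Lemma excludes_max_small (n : Z) : n = 3 \/ n = 4 -> excludes_max n (2 * (n * n)) 3.
Proof.
  intros Hn m y1 y2 y3 y4 e0 e1 e2 Hm R0 R1 R2 E0 E1 E2 B1 B2 B3 B4.
  rewrite Z.abs_le in *.
  destruct Hn as [-> | ->].
  - assert (m <= 6) by lia.
    assert (y1 <= - 3) by lia.
    assert (y1 = - 3 \/ y1 <= -4) as [-> | ?] by lia; lia.
  - lia.
Qed.

(** As [m >= E], the relation for [e0] gives [4 y1 <= - 3 m] and [y2 <= E - m <= 0]; the relation
    for [e1] then needs [y2 > 0]. *)
Lemma excludes_max_2 (E : Z) : 0 < E -> excludes_max 2 E (E - 1).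
Proof.
  intros HE m y1 y2 y3 y4 e0 e1 e2 Hm R0 R1 _ E0 E1 _ B1 B2 B3 _.
  rewrite Z.abs_le in *. lia.
Qed.

(** Descent on the bound: the value [thr + p + 1] is attained by neither [y] nor [- y], so [thr + p]
    is again a bound. *)
Lemma recurrence_bound (n E thr : Z) (y e : nat -> Z) :
  0 <= thr -> excludes_max n E thr ->
  (forall k, y (S (S k)) + 2 * n * y (S k) + (n * n + 1) * y k = e k) ->
  (forall k, Z.abs (e k) <= E) ->
  (exists B, forall k, Z.abs (y k) <= B) ->
  forall k, Z.abs (y k) <= thr.
Proof.
  intros Ht X R HE [B HB].
  assert (HB' : forall k, Z.abs (y k) <= thr + Z.of_nat (Z.to_nat B)).
  { intro k. specialize (HB k). lia. }
  clear HB. revert HB'. generalize (Z.to_nat B). intro p.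
  induction p as [|p IH]; intros HB k.
  - specialize (HB k). lia.
  - apply IH. clear k. intro k.
    assert (y k <> thr + Z.of_nat (S p)).
    { intro Hy. eapply (X (y k) (y (S k)) (y (S (S k))) (y (S (S (S k)))) (y (S (S (S (S k)))))); try apply R; rewrite ?R; try apply HE; try (rewrite Hy; apply HB). lia. }
    (* By linearity [- y] solves the recurrence for [- e], so a minimum is excluded like a
       maximum. *)
    assert (- y k <> thr + Z.of_nat (S p)).
    { intro Hy. apply (X (- y k) (- y (S k)) (- y (S (S k))) (- y (S (S (S k)))) (- y (S (S (S (S k))))) (- e k) (- e (S k)) (- e (S (S k)))); rewrite ?Z.abs_opp; try apply HE; try (rewrite Hy; apply HB); try lia;
      match goal with |- _ = - e ?i => rewrite <- (R i); ring end. }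
    specialize (HB k). lia.
Qed.

(* The second alternative is needed only for [n = 2], where a digit [x] may survive
   one step but leads to a next term of size at least [2 n |x| - E]. *)
Definition sparse (n : Z) (Q : Z -> Prop) : Prop :=
  exists E thr, 0 <= thr /\ excludes_max n E thr /\
    (forall x, Q x -> Z.abs x <= E) /\
    (forall x, Q x -> x <> 0 -> thr < Z.abs x \/ thr + E < 2 * n * Z.abs x).

(** After two consecutive zeros the next term is [e k] and the one after it is [e (k+1) - 2 n e k].
    If [e k] were nonzero, one of the two would exceed [thr]. So [e k = 0] and the zeros
    propagate. *)
Lemma sparse_recurrence_zero (n : Z) (Q : Z -> Prop) (y e : nat -> Z) :
  0 < n -> sparse n Q -> (forall k, Q (e k)) ->
  y O = 0 -> y 1%nat = 0 ->
  (forall k, y (S (S k)) + 2 * n * y (S k) + (n * n + 1) * y k = e k) ->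
  (exists B, forall k, Z.abs (y k) <= B) ->
  forall k, e k = 0.
Proof.
  intros Hn (E & thr & Ht & X & HE & Hsep) HQ Y0 Y1 R HB.
  pose proof (recurrence_bound n E thr y e Ht X R (fun k => HE _ (HQ k)) HB) as Hy.
  assert (step : forall k, y k = 0 -> y (S k) = 0 -> e k = 0).
  { intros k H0 H1. destruct (Z.eq_dec (e k) 0) as [|Hne]; [assumption|exfalso].
    pose proof (R k) as Rk. rewrite H0, H1 in Rk.
    pose proof (R (S k)) as Rk'. rewrite H1 in Rk'.
    pose proof (Hy (S (S k))). pose proof (Hy (S (S (S k)))).
    pose proof (HE _ (HQ (S k))).
    replace (y (S (S k))) with (e k) in * by lia.
    destruct (Hsep _ (HQ k) Hne) as [|Hs]; [lia|].
    rewrite <- (Z.abs_eq (2 * n)), <- Z.abs_mul in Hs by lia. lia. }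
  assert (all : forall k, y k = 0 /\ y (S k) = 0).
  { induction k as [|k [IH0 IH1]]; [tauto|split; [assumption|]].
    pose proof (R k) as Rk. rewrite (step k IH0 IH1), IH0, IH1 in Rk. lia. }
  intro k. apply step; apply all.
Qed.

(** Second differences are bounded by [n^2] when the digits are at most [n^2 / 2], and by [2 n^2]
    otherwise. For [n > 2] the gap hypothesis puts the nonzero ones above the threshold 1, 2 or
    3. *)
Lemma sparse_diff_digits (n : nat) (D : nat -> Prop) :
  (2 <= n)%nat ->
  (forall d, D d -> (d <= n * n)%nat) ->
  ( ((forall d, D d -> (d <= (n * n) / 2)%nat) /\
     (forall x y, diffset D x -> diffset D y -> Z.abs (x - y) <> 1%Z))
    \/ ((5 <= n)%nat /\
     (forall x y, diffset D x -> diffset D y -> x <> y -> (Z.abs (x - y) > 2)%Z))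
    \/ ((n <= 4)%nat /\
     (forall x y, diffset D x -> diffset D y -> x <> y -> (Z.abs (x - y) > 3)%Z)) ) ->
  sparse (Z.of_nat n)
    (fun x => exists y z, diffset D y /\ diffset D z /\ x = y - z).
Proof.
  intros Hn HD H.
  assert (Hfull : forall x, diffset D x -> Z.abs x <= Z.of_nat n * Z.of_nat n).
  { intros x (d & d' & Hd & Hd' & ->). apply HD in Hd, Hd'. nia. }
  destruct H as [[Hhalf Hs]|[[H5 Hs]|[H4 Hs]]].
  - assert (Hh : forall x, diffset D x -> 2 * Z.abs x <= Z.of_nat n * Z.of_nat n).
    { intros x (d & d' & Hd & Hd' & ->). apply Hhalf in Hd, Hd'.
      pose proof (Nat.Div0.mul_div_le (n * n) 2). lia. }
    destruct (Nat.eq_dec n 2) as [->|Hn3].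
    (* Only [|x| >= 2] is known for nonzero [x], but [thr + E = 7 < 8 <= 2 n |x|]. *)
    + exists 4, 3. split; [lia|]. split; [apply (excludes_max_2 4); lia|]. split.
      * intros x (y & z & Hy & Hz & ->). apply Hh in Hy, Hz. lia.
      * intros x (y & z & Hy & Hz & ->) Hne. right.
        specialize (Hs y z Hy Hz). lia.
    + exists (Z.of_nat n * Z.of_nat n), 1. split; [lia|].
      split; [apply excludes_max_half; lia|]. split.
      * intros x (y & z & Hy & Hz & ->). apply Hh in Hy, Hz. lia.
      * intros x (y & z & Hy & Hz & ->) Hne. left.
        specialize (Hs y z Hy Hz). lia.
  - exists (2 * (Z.of_nat n * Z.of_nat n)), 2. split; [lia|].
    split; [apply excludes_max_full; lia|]. split.
    + intros x (y & z & Hy & Hz & ->). apply Hfull in Hy, Hz. lia.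
    + intros x (y & z & Hy & Hz & ->) Hne. left. specialize (Hs y z Hy Hz). lia.
  - destruct (Nat.eq_dec n 2) as [->|Hn3].
    (* Here [|x| >= 4], and [thr + E = 15 < 16 <= 2 n |x|]. *)
    + exists 8, 7. split; [lia|]. split; [apply (excludes_max_2 8); lia|]. split.
      * intros x (y & z & Hy & Hz & ->). apply Hfull in Hy, Hz. lia.
      * intros x (y & z & Hy & Hz & ->) Hne. right.
        specialize (Hs y z Hy Hz). lia.
    + exists (2 * (Z.of_nat n * Z.of_nat n)), 3. split; [lia|].
      split; [apply excludes_max_small; lia|]. split.
      * intros x (y & z & Hy & Hz & ->). apply Hfull in Hy, Hz. lia.
      * intros x (y & z & Hy & Hz & ->) Hne. left. specialize (Hs y z Hy Hz). lia.
Qed.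

Close Scope Z_scope.

(** * Expansions in base [b] with signed integer digits *)

Definition expansion (n : nat) (e : nat -> Z) (z : C) : Prop :=
  is_series (V := C_NormedModule)
    (fun j => Cmult (RtoC (IZR (e j))) (Cinv (Cpow (base n) (S j)))) z.

Lemma attractor_expansion (n : nat) (D : nat -> Prop) (z : C) :
  attractor n D z <->
  exists dig : nat -> nat, (forall j, D (dig j)) /\ expansion n (fun j => Z.of_nat (dig j)) z.
Proof.
  split; intros (dig & Hd & Hs); exists dig; (split; [assumption|]);
    (eapply is_series_ext; [|exact Hs]); intro j; simpl; now rewrite INR_IZR_INZ.
Qed.

(** Since [|b| = sqrt (n^2 + 1)]. The constant 2 gives series with bounded digits a geometric
    majorant of ratio 1/2. *)
Lemma Cmod_base_gt2 (n : nat) : (2 <= n)%nat -> 2 < Cmod (base n).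
Proof.
  intro Hn. apply le_INR in Hn. simpl in Hn.
  unfold Cmod, base; simpl fst; simpl snd.
  rewrite <- (sqrt_pow2 2) by lra. apply sqrt_lt_1; nra.
Qed.

Lemma base_neq0 (n : nat) : base n <> 0.
Proof. intro H. injection H. intros H1 _. lra. Qed.

Lemma expansion_shift (n : nat) (e : nat -> Z) (z : C) :
  expansion n e z ->
  expansion n (fun j => e (S j)) (base n * z - RtoC (IZR (e O)))%C.
Proof.
  intro H. unfold expansion in *.
  pose proof (base_neq0 n) as Hb.
  apply (is_series_scal (base n)) in H.
  match type of H with is_series ?f _ =>
    pose proof (is_series_incr_1 f (base n * z - RtoC (IZR (e O)))%C) as H1 end.
  eapply is_series_ext; [|apply H1].
  - intro j. cbn -[Cpow Cmult]. rewrite (Cpow_S _ (S j)).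
    change (base n * (RtoC (IZR (e (S j))) * / (base n * base n ^ S j)) = RtoC (IZR (e (S j))) * / base n ^ S j)%C.
    field. split; [apply Cpow_nz|]; assumption.
  - match goal with |- is_series _ ?a => replace a with (scal (base n) z : C_NormedModule) end; [exact H|].
    change (base n * z = base n * z - RtoC (IZR (e O)) + base n * (RtoC (IZR (e O)) * / (base n ^ 1)))%C.
    rewrite Cpow_1_r. field. assumption.
Qed.

Lemma expansion_minus (n : nat) (e f : nat -> Z) (z w : C) :
  expansion n e z -> expansion n f w ->
  expansion n (fun j => e j - f j)%Z (z - w)%C.
Proof.
  intros He Hf. eapply is_series_ext; [|apply (is_series_minus _ _ _ _ He Hf)].
  intro j. cbn -[Cpow]. rewrite minus_IZR, RtoC_minus.
  change (RtoC (IZR (e j)) * / base n ^ S j - RtoC (IZR (f j)) * / base n ^ S j =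
    (RtoC (IZR (e j)) - RtoC (IZR (f j))) * / base n ^ S j)%C. ring.
Qed.

Lemma expansion_term_bound (n : nat) (e : nat -> Z) (E : Z) (j : nat) :
  (2 <= n)%nat -> (Z.abs (e j) <= E)%Z ->
  Cmod (RtoC (IZR (e j)) * / (base n ^ S j))%C <= IZR E * / 2 * (/ 2) ^ j.
Proof.
  intros Hn HE. pose proof (Cmod_base_gt2 n Hn) as Hb.
  rewrite Cmod_mult, Cmod_R, Cmod_inv, Cmod_pow by (apply Cpow_nz, base_neq0).
  rewrite <- abs_IZR. apply IZR_le in HE.
  rewrite Rmult_assoc.
  apply Rmult_le_compat; [apply IZR_le; lia| |assumption|].
  - left. apply Rinv_0_lt_compat, pow_lt. lra.
  - change (/ 2 * (/ 2) ^ j) with ((/ 2) ^ S j). rewrite pow_inv.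
    apply Rinv_le_contravar; [apply pow_lt; lra|apply pow_incr; lra].
Qed.

Lemma expansion_exists (n : nat) (e : nat -> Z) (E : Z) :
  (2 <= n)%nat -> (forall j, (Z.abs (e j) <= E)%Z) -> exists z, expansion n e z.
Proof.
  intros Hn HE.
  apply (ex_series_le (V := C_CompleteNormedModule) _ (fun j => IZR E * / 2 * (/ 2) ^ j)).
  - intro j. now apply expansion_term_bound.
  - apply (ex_series_scal (V := R_NormedModule) (IZR E * / 2)). apply ex_series_geom.
    rewrite Rabs_pos_eq; lra.
Qed.

(** The terms are dominated by [E / 2^(j+1)], whose sum is [E]. *)
Lemma expansion_bound (n : nat) (e : nat -> Z) (E : Z) (z : C) :
  (2 <= n)%nat -> (forall j, (Z.abs (e j) <= E)%Z) -> expansion n e z -> Cmod z <= IZR E.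
Proof.
  intros Hn HE H.
  assert (G : is_series (fun j => IZR E * / 2 * (/ 2) ^ j) (IZR E)).
  { refine (eq_ind _ (is_series _)
      (is_series_scal (V := R_NormedModule) (IZR E * / 2) _ _ (is_series_geom (/ 2) _)) _ _).
    - rewrite Rabs_pos_eq; lra.
    - unfold scal; simpl; unfold mult; simpl; field. }
  change (Rbar_le (Cmod z) (IZR E)).
  eapply is_lim_seq_le; [|eapply (filterlim_comp _ _ _ _ _ _ _ _ H (filterlim_norm (V := C_NormedModule) z))|exact G].
  intro k. unfold sum_n. eapply Rle_trans; [apply norm_sum_n_m|].
  apply sum_n_m_le. intro j. now apply expansion_term_bound.
Qed.

(** * Gaussian integer prefixes and uniqueness of expansions *)

Definition gauss (p : Z * Z) : C := (IZR (fst p), IZR (snd p)).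

(* Gaussian integers are stored as pairs; this is [b p + d]. *)
Definition append_digit (n : nat) (p : Z * Z) (d : Z) : Z * Z :=
  (- Z.of_nat n * fst p - snd p + d, fst p - Z.of_nat n * snd p)%Z.

(** This is [b^k] times the [k]-th partial sum, hence a Gaussian integer. *)
Fixpoint prefix (n : nat) (e : nat -> Z) (k : nat) : Z * Z :=
  match k with
  | O => (0, 0)%Z
  | S k => append_digit n (prefix n e k) (e k)
  end.

Lemma gauss_append_digit (n : nat) (p : Z * Z) (d : Z) :
  gauss (append_digit n p d) = (base n * gauss p + RtoC (IZR d))%C.
Proof.
  unfold gauss, append_digit, base, Cmult, Cplus, RtoC; simpl.
  rewrite plus_IZR, !minus_IZR, !mult_IZR, opp_IZR, <- INR_IZR_INZ. f_equal; ring.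
Qed.

Lemma expansion_tail (n : nat) (e : nat -> Z) (z : C) (k : nat) :
  expansion n e z ->
  expansion n (fun j => e (k + j)%nat) (base n ^ k * z - gauss (prefix n e k))%C.
Proof.
  intro H. induction k as [|k IH].
  - simpl. replace (1 * z - gauss (0, 0)%Z)%C with z; [exact H|].
    change (gauss (0, 0)%Z) with (RtoC 0). ring.
  - apply expansion_shift in IH. simpl prefix. rewrite gauss_append_digit.
    replace (base n ^ S k * z - (base n * gauss (prefix n e k) + RtoC (IZR (e k))))%C
      with (base n * (base n ^ k * z - gauss (prefix n e k)) - RtoC (IZR (e (k + 0)%nat)))%C.
    + eapply is_series_ext; [|exact IH]. intro j. simpl. now rewrite Nat.add_succ_r.
    + rewrite Nat.add_0_r, Cpow_S. ring.
Qed.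

(** When the sum is 0, each prefix is minus the value of a tail, so the prefixes stay bounded. Their
    imaginary parts obey the recurrence because [b^2 + 2 n b + n^2 + 1 = 0], and start with 0, 0
    because a single digit is real. *)
Lemma expansion_zero (n : nat) (Q : Z -> Prop) (e : nat -> Z) :
  (2 <= n)%nat -> sparse (Z.of_nat n) Q -> (forall k, Q (e k)) ->
  expansion n e 0 -> forall k, e k = 0%Z.
Proof.
  intros Hn HQ He H.
  pose proof HQ as (E & _ & _ & _ & HE & _).
  apply (sparse_recurrence_zero (Z.of_nat n) Q (fun k => snd (prefix n e k)) e);
    [lia|assumption|assumption|reflexivity|simpl; lia| |].
  - intro k. cbn [prefix append_digit fst snd]. ring.
  - exists E. intro k. apply le_IZR. rewrite abs_IZR.
    apply (expansion_tail _ _ _ k) in H.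
    apply (expansion_bound n _ E) in H; [|assumption|intro j; apply HE, He].
    replace (base n ^ k * 0 - gauss (prefix n e k))%C with (- gauss (prefix n e k))%C in H by ring.
    rewrite Cmod_opp in H. eapply Rle_trans; [|exact H].
    eapply Rle_trans; [|apply Rmax_Cmod]. apply Rmax_r.
Qed.

Lemma expansion_near_prefix (n : nat) (e : nat -> Z) (E : Z) (z : C) (k : nat) :
  (2 <= n)%nat -> (forall j, (Z.abs (e j) <= E)%Z) -> expansion n e z ->
  Cmod (base n ^ k * z - gauss (prefix n e k))%C <= IZR E.
Proof.
  intros Hn HE H. apply (expansion_bound n (fun j => e (k + j)%nat) E);
    [assumption|intro; apply HE|now apply expansion_tail].
Qed.

Lemma prefix_ext (n : nat) (e f : nat -> Z) (k : nat) :
  (forall j, (j < k)%nat -> e j = f j) -> prefix n e k = prefix n f k.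
Proof.
  induction k as [|k IH]; intro H; [reflexivity|simpl].
  rewrite IH by (intros; apply H; lia). now rewrite H by lia.
Qed.

(** * Enumeration of prefixes without repetition *)

Fixpoint prefixes (n : nat) (A : nat -> list nat) (k : nat) : list (Z * Z) :=
  match k with
  | O => (0, 0)%Z :: nil
  | S k => flat_map (fun p => map (fun d => append_digit n p (Z.of_nat d)) (A k)) (prefixes n A k)
  end.

Lemma length_prefixes_S (n : nat) (A : nat -> list nat) (k : nat) :
  length (prefixes n A (S k)) = (length (prefixes n A k) * length (A k))%nat.
Proof. simpl. apply flat_map_constant_length. intros. apply length_map. Qed.

(** The digits [0, ..., n^2] are distinct residues modulo [b]: equality makes [d - d'] a multiple of
    the norm [n^2 + 1]. *)
Lemma append_digit_inj (n : nat) (p q : Z * Z) (d d' : nat) :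
  (d <= n * n)%nat -> (d' <= n * n)%nat ->
  append_digit n p (Z.of_nat d) = append_digit n q (Z.of_nat d') -> p = q /\ d = d'.
Proof.
  destruct p as [x y], q as [x' y']. unfold append_digit. simpl. intros Hd Hd' H.
  injection H. intros H2 H1.
  assert (Hx : (x - x' = Z.of_nat n * (y - y'))%Z) by lia.
  assert (Hdy : (Z.of_nat d - Z.of_nat d' = (Z.of_nat n * Z.of_nat n + 1) * (y - y'))%Z).
  { replace (Z.of_nat d - Z.of_nat d')%Z with (Z.of_nat n * (x - x') + (y - y'))%Z by lia.
    rewrite Hx. ring. }
  assert (Hy : (y - y' = 0)%Z).
  { assert (Z.of_nat d <= Z.of_nat n * Z.of_nat n)%Z by lia.
    assert (Z.of_nat d' <= Z.of_nat n * Z.of_nat n)%Z by lia. nia. }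
  rewrite Hy in *. split; [f_equal|]; lia.
Qed.

Lemma NoDup_flat_map_inj {T U V : Type} (f : T -> U -> V) (l : list T) (l' : list U) :
  (forall a a' u u', In u l' -> In u' l' -> f a u = f a' u' -> a = a' /\ u = u') ->
  NoDup l -> NoDup l' -> NoDup (flat_map (fun a => map (f a) l') l).
Proof.
  intros Hinj Hl Hl'. induction Hl as [|a l Ha Hl IH]; simpl; [constructor|].
  apply NoDup_app; [|assumption|].
  - apply NoDup_map_NoDup_ForallPairs; [|assumption].
    intros u u' Hu Hu' E. now apply (Hinj a a u u').
  - intros v Hv Hv'. apply in_map_iff in Hv as (u & <- & Hu).
    apply in_flat_map in Hv' as (a' & Ha' & Hv').
    apply in_map_iff in Hv' as (u' & E & Hu').
    destruct (Hinj a' a u' u Hu' Hu E) as [-> _]. contradiction.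
Qed.

(** * Lattice points near a complex number, and choice of scales *)

Definition lattice_box (r : nat) (c : C) : list (Z * Z) :=
  list_prod
    (map (fun i => up (fst c) - Z.of_nat r - 1 + Z.of_nat i)%Z (List.seq 0 (2 * r + 2)))
    (map (fun i => up (snd c) - Z.of_nat r - 1 + Z.of_nat i)%Z (List.seq 0 (2 * r + 2))).

(** Since [x < up x <= x + 1], integers within [r] of [x] lie between [up x - r - 1] and [up x + r],
    hence the length [2 r + 2]. *)
Lemma interval_list (r : nat) (x : R) (m : Z) :
  Rabs (IZR m - x) <= INR r ->
  In m (map (fun i => up x - Z.of_nat r - 1 + Z.of_nat i)%Z (List.seq 0 (2 * r + 2))).
Proof.
  intro H. destruct (archimed x) as [H1 H2].
  apply Rabs_le_between in H. rewrite INR_IZR_INZ in H.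
  assert (L1 : (m < up x + Z.of_nat r + 1)%Z).
  { apply lt_IZR. rewrite !plus_IZR. lra. }
  assert (L2 : (up x - 1 - Z.of_nat r <= m)%Z).
  { apply le_IZR. rewrite !minus_IZR. lra. }
  apply in_map_iff. exists (Z.to_nat (m - (up x - Z.of_nat r - 1))). split; [lia|].
  apply in_seq. lia.
Qed.

Lemma lattice_box_spec (r : nat) (c : C) (p : Z * Z) :
  Cmod (gauss p - c) <= INR r -> In p (lattice_box r c).
Proof.
  intro H. destruct p as [x y].
  pose proof (Rmax_Cmod (gauss (x, y) - c)%C) as M.
  apply in_prod; apply interval_list; (eapply Rle_trans; [|exact H]);
    (eapply Rle_trans; [|exact M]); [apply Rmax_l|apply Rmax_r].
Qed.

Lemma pow_exceeds (rho x : R) : 1 < rho -> exists k, x <= rho ^ k.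
Proof.
  intro H. destruct (Pow_x_infinity rho) with (b := x) as [k Hk].
  - rewrite Rabs_pos_eq; lra.
  - exists k. specialize (Hk k (le_n k)). rewrite Rabs_pos_eq in Hk; [lra|apply pow_le; lra].
Qed.

(** Chooses the cylinder level whose size matches a covering radius [delta]. *)
Lemma pow_scale (rho delta : R) :
  1 < rho -> 0 < delta < 1 -> exists k, delta * rho ^ k <= 1 /\ 1 <= delta * rho ^ S k.
Proof.
  intros Hr Hd. destruct (pow_exceeds rho (/ delta) Hr) as [N HN].
  assert (H1 : 1 <= delta * rho ^ N).
  { apply (Rmult_le_compat_l delta) in HN; [|lra]. rewrite Rinv_r in HN; lra. }
  clear HN. induction N as [|N IH]; [simpl in H1; lra|].
  destruct (Rle_dec 1 (delta * rho ^ N)) as [H|H]; [auto|]. exists N. lra.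
Qed.

(** * Box dimension of sets given by digit restrictions *)

Section DigitSystem.

Variables (n : nat) (A : nat -> list nat).
Hypothesis n_ge2 : (2 <= n)%nat.
Hypothesis A_le : forall k d, In d (A k) -> (d <= n * n)%nat.
Hypothesis A_NoDup : forall k, NoDup (A k).
Hypothesis A_inhabited : forall k, exists d, In d (A k).

(** The admissible digits vary with the position, since for [C(alpha)] they depend on the digits of
    [alpha]. *)
Definition digit_set (z : C) : Prop :=
  exists dig : nat -> nat, (forall k, In (dig k) (A k)) /\ expansion n (fun k => Z.of_nat (dig k)) z.

Lemma prefixes_NoDup (k : nat) : NoDup (prefixes n A k).
Proof.
  induction k as [|k IH]; simpl; [repeat constructor; simpl; tauto|].
  apply (NoDup_flat_map_inj (fun p d => append_digit n p (Z.of_nat d))); auto.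
  intros p q d d' Hd Hd'. apply append_digit_inj; eauto.
Qed.

Lemma prefix_in_prefixes (dig : nat -> nat) (k : nat) :
  (forall k, In (dig k) (A k)) -> In (prefix n (fun k => Z.of_nat (dig k)) k) (prefixes n A k).
Proof.
  intro H. induction k as [|k IH]; simpl; [tauto|].
  apply in_flat_map. eexists. split; [exact IH|].
  apply (in_map (fun d => append_digit n _ (Z.of_nat d))), H.
Qed.

Lemma prefixes_prefix (k : nat) (p : Z * Z) :
  In p (prefixes n A k) ->
  exists dig : nat -> nat, (forall k, In (dig k) (A k)) /\
    prefix n (fun k => Z.of_nat (dig k)) k = p.
Proof.
  revert p. induction k as [|k IH]; simpl; intros p Hp.
  - destruct Hp as [<-|[]].
    exists (fun k => proj1_sig (constructive_indefinite_description _ (A_inhabited k))).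
    split; [|reflexivity]. intro k. apply proj2_sig.
  - apply in_flat_map in Hp as (q & Hq & Hp). apply in_map_iff in Hp as (d & <- & Hd).
    destruct (IH q Hq) as (dig & Hdig & <-).
    exists (fun j => if Nat.eq_dec j k then d else dig j). split.
    + intro j. destruct (Nat.eq_dec j k) as [->|]; auto.
    + destruct (Nat.eq_dec k k) as [_|]; [|lia]. f_equal.
      apply prefix_ext. intros j Hj. destruct (Nat.eq_dec j k); [lia|reflexivity].
Qed.

Lemma digits_bound (dig : nat -> nat) :
  (forall k, In (dig k) (A k)) -> forall k, (Z.abs (Z.of_nat (dig k)) <= Z.of_nat (n * n))%Z.
Proof. intros H k. specialize (A_le k _ (H k)). lia. Qed.

Lemma digit_set_inhabited : exists z, digit_set z.
Proof.
  destruct (prefixes_prefix 0 (0, 0)%Z) as (dig & Hdig & _); [now left|].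
  destruct (expansion_exists n (fun k => Z.of_nat (dig k)) (Z.of_nat (n * n))) as [z Hz];
    [assumption|now apply digits_bound|]. now exists z, dig.
Qed.

(** Discs around the base points of the level-[k] cylinders suffice, a tail being at most
    [n^2 |b|^-k]. *)
Lemma digit_set_covered (k : nat) (delta : R) :
  INR (n * n) <= delta * Cmod (base n) ^ k ->
  covered_by digit_set delta (length (prefixes n A k)).
Proof.
  intro Hdelta.
  exists (fun i => gauss (nth i (prefixes n A k) (0, 0)%Z) / base n ^ k)%C.
  intros z (dig & Hdig & Hz).
  destruct (In_nth _ _ (0, 0)%Z (prefix_in_prefixes dig k Hdig)) as (i & Hi & E).
  exists i. split; [assumption|]. rewrite E.
  pose proof (expansion_near_prefix n _ (Z.of_nat (n * n)) z k n_ge2 (digits_bound dig Hdig) Hz) as B.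
  pose proof (Cmod_base_gt2 n n_ge2) as Hb.
  assert (Hbk : 0 < Cmod (base n) ^ k) by (apply pow_lt; lra).
  apply (Rmult_le_reg_r (Cmod (base n) ^ k)); [assumption|].
  rewrite <- Cmod_pow, <- Cmod_mult, Cmod_pow.
  eapply Rle_trans; [|exact Hdelta]. rewrite INR_IZR_INZ.
  eapply Rle_trans; [|exact B]. right. f_equal. field. apply Cpow_nz, base_neq0.
Qed.

(** Lattice points allowed in a box of radius [n^2 + 1]: the tail accounts for [n^2], the rescaled
    disc for 1. *)
Definition overlap : nat := (2 * (n * n + 1) + 2) * (2 * (n * n + 1) + 2).

Lemma length_lattice_box (c : C) : length (lattice_box (n * n + 1) c) = overlap.
Proof. unfold lattice_box. now rewrite length_prod, !length_map, !length_seq. Qed.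

(* A disc of radius [|b|^-k] meets boundedly many level-[k] cylinders: rescaling by
   [b^k] turns their base points into distinct Gaussian integers. *)
Lemma digit_set_cover_lower (k m : nat) (delta : R) :
  delta * Cmod (base n) ^ k <= 1 -> covered_by digit_set delta m ->
  (length (prefixes n A k) <= m * overlap)%nat.
Proof.
  intros Hdelta [c Hc].
  pose proof (Cmod_base_gt2 n n_ge2) as Hb.
  assert (Hbk : 0 < Cmod (base n) ^ k) by (apply pow_lt; lra).
  replace m with (length (List.seq 0 m)) by apply length_seq.
  rewrite <- (flat_map_constant_length (c := overlap)
    (fun i => lattice_box (n * n + 1) (c i * base n ^ k)%C))
    by (intros; apply length_lattice_box).
  apply NoDup_incl_length; [apply prefixes_NoDup|].
  intros p Hp. destruct (prefixes_prefix k p Hp) as (dig & Hdig & <-).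
  destruct (expansion_exists n (fun k => Z.of_nat (dig k)) (Z.of_nat (n * n))) as [z Hz];
    [assumption|now apply digits_bound|].
  destruct (Hc z) as (i & Hi & Hzi); [now exists dig|].
  apply in_flat_map. exists i. split; [apply in_seq; lia|].
  apply lattice_box_spec.
  pose proof (expansion_near_prefix n _ (Z.of_nat (n * n)) z k n_ge2 (digits_bound dig Hdig) Hz) as B.
  set (p := gauss _) in *.
  replace (p - c i * base n ^ k)%C
    with (- (base n ^ k * z - p) + (z - c i) * base n ^ k)%C by ring.
  eapply Rle_trans; [apply Cmod_triangle|].
  rewrite Cmod_opp, Cmod_mult, Cmod_pow, plus_INR, (INR_IZR_INZ (n * n)).
  apply Rplus_le_compat; [exact B|].
  eapply Rle_trans; [|exact Hdelta]. apply Rmult_le_compat_r; lra.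
Qed.

Lemma prefixes_length_pos (k : nat) : (0 < length (prefixes n A k))%nat.
Proof.
  destruct (prefixes_prefix 0 (0, 0)%Z) as (dig & Hdig & _); [now left|].
  pose proof (prefix_in_prefixes dig k Hdig) as H.
  destruct (prefixes n A k); [contradiction|simpl; lia].
Qed.

(** With [P k] the number of level-[k] prefixes and [delta] between [|b|^-(k+1)] and [|b|^-k], the
    least cover has size between [P k / overlap] and [P (k+1+q)]. Its logarithm is thus within a
    constant of [l (- ln delta) / ln |b|], and the error vanishes after division by [- ln delta]. *)
Lemma digit_set_box_dim (l B : R) :
  0 <= l ->
  (forall k, Rabs (ln (INR (length (prefixes n A k))) - INR k * l) <= B) ->
  has_box_dim digit_set (l / ln (Cmod (base n))).
Proof.
  intros Hl HB. pose proof (Cmod_base_gt2 n n_ge2) as Hb.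
  set (rho := Cmod (base n)) in *.
  assert (HL : 0 < ln rho) by (rewrite <- ln_1; apply ln_increasing; lra).
  split.
  - intros delta Hdelta.
    destruct (pow_exceeds rho (INR (n * n) / delta)) as [k Hk]; [lra|].
    exists (length (prefixes n A k)). apply digit_set_covered. fold rho.
    apply (Rmult_le_compat_l delta) in Hk; [|lra].
    replace (delta * (INR (n * n) / delta)) with (INR (n * n)) in Hk by (field; lra).
    exact Hk.
  (* Going [q] levels deeper absorbs the factor [n^2] in the covering radius. *)
  - destruct (pow_exceeds rho (INR (n * n))) as [q Hq]; [lra|].
    assert (HB0 : 0 <= B) by (eapply Rle_trans; [apply Rabs_pos|apply (HB O)]).
    assert (HK : 1 <= INR overlap).
    { apply (le_INR 1). unfold overlap. nia. }
    assert (HlnK : 0 <= ln (INR overlap)) by (rewrite <- ln_1; apply ln_le; lra).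
    (* Total error: [1 + q] levels, the deviation [B] of the counts, and the overlap factor. *)
    set (B' := (1 + INR q) * l + B + ln (INR overlap)).
    assert (HB' : 0 <= B').
    { unfold B'. pose proof (pos_INR q). assert (0 <= (1 + INR q) * l) by (apply Rmult_le_pos; lra). lra. }
    (* This [delta0] makes [B' < eps (- ln delta)]. *)
    intros eps Heps. exists (exp (- (B' / eps))). split; [apply exp_pos|].
    intros delta m [Hd0 Hd1] [Hcov Hmin].
    assert (HX : B' / eps < - ln delta).
    { apply ln_increasing in Hd1; [|lra]. rewrite ln_exp in Hd1. lra. }
    assert (HBe : 0 <= B' / eps) by (apply Rle_mult_inv_pos; lra).
    assert (Hdelta1 : delta < 1).
    { apply ln_lt_inv; [lra|lra|]. rewrite ln_1. lra. }
    destruct (pow_scale rho delta) as (k & Hk0 & Hk1); [lra|lra|].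
    pose proof (digit_set_cover_lower k m delta Hk0 Hcov) as Hlow.
    assert (Hup : (m <= length (prefixes n A (S k + q)))%nat).
    { apply Hmin, digit_set_covered. fold rho. rewrite pow_add, <- Rmult_assoc.
      rewrite <- (Rmult_1_l (INR (n * n))).
      apply Rmult_le_compat; [lra|apply pos_INR|lra|exact Hq]. }
    pose proof (prefixes_length_pos k) as Hpos.
    assert (Hm : (0 < m)%nat) by nia.
    apply le_INR in Hlow, Hup. rewrite mult_INR in Hlow. apply lt_INR in Hpos, Hm.
    simpl in Hpos, Hm.
    apply ln_le in Hlow; [|assumption]. rewrite ln_mult in Hlow by lra.
    apply ln_le in Hup; [|assumption].
    pose proof (HB k) as Bk. pose proof (HB (S k + q)%nat) as Bq.
    apply Rabs_le_between in Bk, Bq. rewrite plus_INR, S_INR in Bq.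
    apply ln_le in Hk0; [|apply Rmult_lt_0_compat; [lra|apply pow_lt; lra]].
    rewrite ln_mult, ln_pow, ln_1 in Hk0 by (try apply pow_lt; lra).
    apply ln_le in Hk1; [|lra].
    rewrite ln_mult, ln_pow, ln_1, S_INR in Hk1 by (try apply pow_lt; lra).
    set (X := - ln delta) in *.
    assert (S0 : INR k * l <= l / ln rho * X).
    { replace (INR k * l) with (l / ln rho * (INR k * ln rho)) by (field; lra).
      apply Rmult_le_compat_l; [apply Rle_mult_inv_pos; lra|unfold X; lra]. }
    assert (S1 : l / ln rho * X <= (INR k + 1) * l).
    { replace ((INR k + 1) * l) with (l / ln rho * ((INR k + 1) * ln rho)) by (field; lra).
      apply Rmult_le_compat_l; [apply Rle_mult_inv_pos; lra|unfold X; lra]. }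
    assert (HX0 : 0 < X) by lra.
    replace (ln (INR m) / X - l / ln rho) with ((ln (INR m) - l / ln rho * X) / X)
      by (field; lra).
    unfold Rdiv at 1. rewrite Rabs_mult, (Rabs_pos_eq (/ X)) by (left; now apply Rinv_0_lt_compat).
    apply (Rmult_lt_reg_r X); [assumption|]. rewrite Rmult_assoc, Rinv_l, Rmult_1_r by lra.
    apply (Rmult_lt_compat_l eps) in HX; [|assumption].
    replace (eps * (B' / eps)) with B' in HX by (field; lra).
    eapply Rle_lt_trans; [|exact HX]. apply Rabs_le_between.
    pose proof (pos_INR q). assert (0 <= INR q * l) by (apply Rmult_le_pos; lra).
    unfold B'. lra.
Qed.

End DigitSystem.

(** * Extensionality and uniqueness of the box dimension *)

Lemma has_box_dim_ext (A A' : C -> Prop) (s : R) :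
  (forall z, A z <-> A' z) -> has_box_dim A s -> has_box_dim A' s.
Proof.
  intro H. replace A' with A; [tauto|].
  apply functional_extensionality. intro z. apply propositional_extensionality, H.
Qed.

Lemma min_cover_exists (A : C -> Prop) (delta : R) (k : nat) :
  covered_by A delta k -> exists m, min_cover A delta m.
Proof.
  intro H. apply NNPP. intro Hno. revert H.
  induction k as [k IH] using (well_founded_induction lt_wf). intro Hk.
  apply Hno. exists k. split; [assumption|]. intros m Hm.
  destruct (le_lt_dec k m) as [|Hlt]; [assumption|]. destruct (IH m Hlt Hm).
Qed.

(** Finite coverability supplies a least cover at a scale below both thresholds, so that both limit
    conditions apply to the same quotient. *)
Lemma has_box_dim_unique (A : C -> Prop) (s s' : R) :
  has_box_dim A s -> has_box_dim A s' -> s = s'.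
Proof.
  intros [Hc H] [_ H']. apply NNPP. intro Hne.
  assert (He : 0 < Rabs (s - s') / 2).
  { apply Rlt_mult_inv_pos; [apply Rabs_pos_lt|]; lra. }
  destruct (H _ He) as (d & Hd & K), (H' _ He) as (d' & Hd' & K').
  assert (Hm : 0 < Rmin d d') by (apply Rmin_pos; assumption).
  pose proof (Rmin_l d d'). pose proof (Rmin_r d d').
  destruct (Hc (Rmin d d' / 2)) as [k Hk]; [lra|].
  apply min_cover_exists in Hk as [m Hmin].
  specialize (K (Rmin d d' / 2) m ltac:(lra) Hmin).
  specialize (K' (Rmin d d' / 2) m ltac:(lra) Hmin).
  set (x := ln (INR m) / - ln (Rmin d d' / 2)) in *.
  assert (T : Rabs (s - s') <= Rabs (x - s) + Rabs (x - s')).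
  { replace (s - s') with (- (x - s) + (x - s')) by ring.
    eapply Rle_trans; [apply Rabs_triang|]. rewrite Rabs_Ropp. lra. }
  lra.
Qed.

(** * Digits common to [D] and a translate of [D] *)

Definition bounded_list (N : nat) (P : nat -> Prop) : list nat :=
  filter (fun d => if excluded_middle_informative (P d) then true else false) (List.seq 0 (S N)).

Lemma bounded_list_NoDup (N : nat) (P : nat -> Prop) : NoDup (bounded_list N P).
Proof. apply NoDup_filter, seq_NoDup. Qed.

Lemma bounded_list_spec (N : nat) (P : nat -> Prop) (d : nat) :
  In d (bounded_list N P) <-> (d <= N)%nat /\ P d.
Proof.
  unfold bounded_list. rewrite filter_In, in_seq.
  destruct (excluded_middle_informative (P d)); intuition (try lia; try discriminate).
Qed.

Lemma list_argmax (f : nat -> Z) (l : list nat) (x : nat) :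
  In x l -> exists m, In m l /\ forall d, In d l -> (f d <= f m)%Z.
Proof.
  intro Hx. assert (Hl : l <> nil) by (intros ->; contradiction). clear x Hx.
  induction l as [|a l IH]; [congruence|].
  destruct l as [|a' l]; [exists a; simpl; intuition (subst; lia)|].
  destruct IH as (m & Hm & Hmax); [discriminate|].
  destruct (Z_le_dec (f m) (f a)) as [Hle|Hlt].
  - exists a. split; [now left|]. intros d [<-|Hd]; [lia|]. specialize (Hmax d Hd). lia.
  - exists m. split; [now right|]. intros d [<-|Hd]; [lia|auto].
Qed.

(** The intersection of [D] with [D + x]. *)
Definition common_digits (n : nat) (D : nat -> Prop) (x : Z) : list nat :=
  bounded_list (n * n) (fun d => D d /\ exists d', D d' /\ x = (Z.of_nat d - Z.of_nat d')%Z).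

Lemma common_digits_inhabited (n : nat) (D : nat -> Prop) (x : Z) :
  (forall d, D d -> (d <= n * n)%nat) -> diffset D x -> exists d, In d (common_digits n D x).
Proof.
  intros HD (d & d' & Hd & Hd' & Hx). exists d. apply bounded_list_spec. eauto 6.
Qed.

Lemma length_common_digits_zero (n : nat) (D : nat -> Prop) :
  length (common_digits n D 0) = length (bounded_list (n * n) D).
Proof.
  apply Nat.le_antisymm; apply NoDup_incl_length; try apply bounded_list_NoDup;
    intros d Hd; apply bounded_list_spec in Hd; apply bounded_list_spec.
  - tauto.
  - destruct Hd as [Hle Hd]. repeat split; [assumption|assumption|].
    exists d. split; [assumption|lia].
Qed.

Lemma length_common_digits_le (n : nat) (D : nat -> Prop) (x : Z) :
  (length (common_digits n D x) <= length (bounded_list (n * n) D))%nat.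
Proof.
  apply NoDup_incl_length; [apply bounded_list_NoDup|].
  intros d Hd. apply bounded_list_spec in Hd. apply bounded_list_spec. tauto.
Qed.

(** The largest difference is represented only by the pair of extreme digits. *)
Lemma length_common_digits_extreme (n : nat) (D : nat -> Prop) (dmin dmax : nat) :
  D dmin -> D dmax ->
  (forall d, D d -> (dmin <= d <= dmax)%nat) -> (dmax <= n * n)%nat ->
  length (common_digits n D (Z.of_nat dmax - Z.of_nat dmin)) = 1%nat.
Proof.
  intros Hmin Hmax H Hle.
  change 1%nat with (length (dmax :: nil)).
  apply Nat.le_antisymm; apply NoDup_incl_length.
  - apply bounded_list_NoDup.
  - intros d Hd. apply bounded_list_spec in Hd as (_ & Hd & d' & Hd' & E).
    left. apply H in Hd, Hd'. lia.
  - repeat constructor. intros [].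
  - intros d [<-|[]]. apply bounded_list_spec. eauto 6.
Qed.

(** Subtracting [delta] digitwise turns an expansion of [z] with common digits into one of
    [z - beta] with digits in [D]. Conversely, digits of [z] and [z - beta] must differ by [delta],
    by uniqueness of expansions. *)
Lemma inter_set_digit_set (n : nat) (D : nat -> Prop) (delta : nat -> Z) (beta z : C) :
  (2 <= n)%nat -> (forall d, D d -> (d <= n * n)%nat) ->
  sparse (Z.of_nat n)
    (fun x => exists y z, diffset D y /\ diffset D z /\ x = (y - z)%Z) ->
  (forall k, diffset D (delta k)) -> expansion n delta beta ->
  digit_set n (fun k => common_digits n D (delta k)) z <-> inter_set n D beta z.
Proof.
  intros Hn HD Hs Hdelta Hbeta. unfold inter_set. rewrite !attractor_expansion. split.
  - intros (dig & Hdig & Hz). split.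
    + exists dig. split; [|assumption]. intro k.
      specialize (Hdig k). apply bounded_list_spec in Hdig. tauto.
    + assert (H : forall k, exists d', D d' /\ delta k = (Z.of_nat (dig k) - Z.of_nat d')%Z).
      { intro k. specialize (Hdig k). apply bounded_list_spec in Hdig. tauto. }
      exists (fun k => Z.to_nat (Z.of_nat (dig k) - delta k)). split.
      * intro k. destruct (H k) as (d' & Hd' & ->).
        replace (Z.to_nat _) with d' by lia. assumption.
      * eapply is_series_ext; [|exact (expansion_minus _ _ _ _ _ Hz Hbeta)].
        intro k. simpl. destruct (H k) as (d' & _ & E).
        rewrite Z2Nat.id by lia. reflexivity.
  - intros [(dig & Hdig & Hz) (dig' & Hdig' & Hz')].
    exists dig. split; [|assumption]. intro k. apply bounded_list_spec.
    repeat split; auto. exists (dig' k). split; [auto|].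
    (* The digits [dig - dig' - delta] lie in the second difference set and their series sums to
       0. *)
    pose proof (expansion_minus _ _ _ _ _ (expansion_minus _ _ _ _ _ Hz Hz') Hbeta) as H.
    replace (z - (z - beta) - beta)%C with (RtoC 0) in H by ring.
    pose proof (expansion_zero n _
      (fun j => Z.of_nat (dig j) - Z.of_nat (dig' j) - delta j)%Z Hn Hs) as U.
    assert (E : (Z.of_nat (dig k) - Z.of_nat (dig' k) - delta k = 0)%Z); [|lia].
    apply U; [|exact H]. intro j. exists (Z.of_nat (dig j) - Z.of_nat (dig' j))%Z, (delta j).
    split; [|split; [apply Hdelta|reflexivity]]. exists (dig j), (dig' j). auto.
Qed.

(** With a constant digit list there are exactly [|D|^k] prefixes, so the growth estimate holds with
    error 0. *)
Lemma attractor_box_dim (n : nat) (D : nat -> Prop) (d0 : nat) :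
  (2 <= n)%nat -> (forall d, D d -> (d <= n * n)%nat) -> D d0 ->
  has_box_dim (attractor n D) (ln (INR (length (bounded_list (n * n) D))) / ln (Cmod (base n))).
Proof.
  intros Hn HD Hd0.
  assert (In0 : In d0 (bounded_list (n * n) D)) by (apply bounded_list_spec; auto).
  assert (HN : 1 <= INR (length (bounded_list (n * n) D))).
  { apply (le_INR 1). destruct (bounded_list (n * n) D); [contradiction|simpl; lia]. }
  apply (has_box_dim_ext (digit_set n (fun _ => bounded_list (n * n) D))).
  - intro z. rewrite attractor_expansion. split; intros (dig & Hdig & Hz); exists dig;
      (split; [|assumption]); intro k; specialize (Hdig k).
    + now apply bounded_list_spec in Hdig.
    + apply bounded_list_spec. auto.
  - apply digit_set_box_dim with (B := 0).
    + assumption.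
    + intros _ d Hd. now apply bounded_list_spec in Hd.
    + intro. apply bounded_list_NoDup.
    + intro. now exists d0.
    + rewrite <- ln_1. apply ln_le; lra.
    + intro k. right. rewrite <- Rabs_R0. f_equal. apply Rminus_diag_eq.
      induction k as [|k IH]; [simpl; rewrite ln_1; ring|].
      rewrite length_prefixes_S, mult_INR, S_INR, ln_mult; [rewrite IH; ring| |lra].
      apply lt_0_INR, prefixes_length_pos; [assumption|]. intro. now exists d0.
Qed.

(** * Growth of the prefix count along the jumps of [k t] *)

Lemma up_step (r t : R) :
  0 <= t <= 1 -> up (r + t) = up r \/ up (r + t) = (up r + 1)%Z.
Proof.
  intro Ht. destruct (archimed r) as [H1 H2], (archimed (r + t)) as [H3 H4].
  assert (up r - 1 < up (r + t))%Z by (apply lt_IZR; rewrite minus_IZR; lra).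
  assert (up (r + t) < up r + 2)%Z by (apply lt_IZR; rewrite plus_IZR; lra).
  lia.
Qed.

(** From [J] on, the count is multiplied by [N] exactly when [up (k t)] increases by 1, so its
    logarithm follows [up (k t) ln N]. *)
Lemma prefixes_growth (n J N : nat) (A : nat -> list nat) (t : R) :
  (1 <= N)%nat -> 0 <= t <= 1 ->
  (forall k, (1 <= length (A k) <= N)%nat) ->
  (forall k, (J <= k)%nat -> up (INR (S k) * t) = up (INR k * t) -> length (A k) = 1%nat) ->
  (forall k, (J <= k)%nat -> up (INR (S k) * t) <> up (INR k * t) -> length (A k) = N) ->
  forall k, Rabs (ln (INR (length (prefixes n A k))) - INR k * (t * ln (INR N)))
    <= (INR J + 2) * ln (INR N).
Proof.
  intros HN Ht HA Hflat Hjump.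
  assert (LN : 0 <= ln (INR N)).
  { rewrite <- ln_1. apply ln_le; [lra|]. now apply (le_INR 1). }
  assert (Hpos : forall k, (1 <= length (prefixes n A k))%nat).
  { induction k as [|k IH]; [simpl; lia|]. rewrite length_prefixes_S.
    specialize (HA k). nia. }
  (* Each of the first [J] steps costs at most [ln N]; the extra 1 is the initial value
     [up 0 = 1]. *)
  assert (K : forall k, Rabs (ln (INR (length (prefixes n A k))) - IZR (up (INR k * t)) * ln (INR N))
    <= (INR (Nat.min k J) + 1) * ln (INR N)).
  { induction k as [|k IH].
    - simpl Nat.min. simpl length. simpl INR. rewrite ln_1, Rmult_0_l.
      replace (up 0) with 1%Z by (apply tech_up; lra).
      apply Rabs_le_between. lra.
    - rewrite length_prefixes_S, mult_INR.
      rewrite ln_mult by (apply lt_0_INR; first [apply (Hpos k)|apply (HA k)]).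
      specialize (Hpos k). specialize (Hflat k). specialize (Hjump k).
      destruct (HA k) as [HA1 HA2].
      assert (0 <= ln (INR (length (A k))) <= ln (INR N)).
      { apply le_INR in HA1, HA2. simpl in HA1. split; [rewrite <- ln_1|]; apply ln_le; lra. }
      pose proof (up_step (INR k * t) t Ht) as Hup.
      replace (INR k * t + t) with (INR (S k) * t) in Hup by (rewrite S_INR; ring).
      apply Rabs_le_between in IH. apply Rabs_le_between.
      destruct (le_lt_dec J k) as [HJ|HJ].
      + rewrite Nat.min_r in * by lia.
        destruct Hup as [E|E].
        * rewrite Hflat, E by assumption. simpl (INR 1). rewrite ln_1. lra.
        * rewrite Hjump by (rewrite ?E; lia). rewrite E, plus_IZR. lra.
      + rewrite Nat.min_l in * by lia.
        destruct Hup as [-> | ->]; rewrite S_INR, ?plus_IZR; lra. }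
  intro k. specialize (K k). destruct (archimed (INR k * t)) as [U1 U2].
  assert (INR (Nat.min k J) <= INR J) by (apply le_INR; lia).
  apply Rabs_le_between in K. apply Rabs_le_between.
  set (L := ln (INR N)) in *. set (u := IZR (up (INR k * t))) in *.
  (* Replacing [up (k t)] by [k t] costs one more [ln N]. *)
  assert (0 <= (u - INR k * t) * L <= 1 * L).
  { split; [apply Rmult_le_pos; lra|apply Rmult_le_compat_r; lra]. }
  assert ((INR (Nat.min k J) + 1) * L <= (INR J + 1) * L) by (apply Rmult_le_compat_r; lra).
  lra.
Qed.

(** * Approximation by prescribed digits and density of the level sets *)

Lemma expansion_close (n J : nat) (e f : nat -> Z) (E : Z) (z w : C) :
  (2 <= n)%nat -> (forall k, (Z.abs (e k) <= E)%Z) -> (forall k, (Z.abs (f k) <= E)%Z) ->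
  (forall k, (k < J)%nat -> e k = f k) -> expansion n e z -> expansion n f w ->
  Cmod (z - w) * Cmod (base n) ^ J <= 2 * IZR E.
Proof.
  intros Hn He Hf Hef Hz Hw.
  pose proof (expansion_near_prefix n e E z J Hn He Hz) as H1.
  pose proof (expansion_near_prefix n f E w J Hn Hf Hw) as H2.
  rewrite (prefix_ext n e f J Hef) in H1. set (p := gauss _) in *.
  rewrite <- Cmod_pow, <- Cmod_mult.
  replace ((z - w) * base n ^ J)%C
    with ((base n ^ J * z - p) + - (base n ^ J * w - p))%C by ring.
  eapply Rle_trans; [apply Cmod_triangle|]. rewrite Cmod_opp. lra.
Qed.

Theorem theorem1p9 (n : nat) (D : nat -> Prop) :
  (2 <= n)%nat ->
  (forall d, D d -> (d <= n * n)%nat) ->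
  ( ((forall d, D d -> (d <= (n * n) / 2)%nat) /\
     (forall x y, diffset D x -> diffset D y -> Z.abs (x - y) <> 1%Z))
    \/ ((5 <= n)%nat /\
     (forall x y, diffset D x -> diffset D y -> x <> y -> (Z.abs (x - y) > 2)%Z))
    \/ ((n <= 4)%nat /\
     (forall x y, diffset D x -> diffset D y -> x <> y -> (Z.abs (x - y) > 3)%Z)) ) ->
  forall s : R, has_box_dim (attractor n D) s ->
  forall lambda : R, 0 <= lambda <= s ->
  forall alpha : C, Fset n D alpha ->
  forall eps : R, 0 < eps ->
  exists beta : C, Cmod (Cminus beta alpha) < eps /\ Phi_eq n D beta lambda.
Proof.
  intros Hn HD Hcases s Hs lambda Hlambda alpha (z & Hz & Hz') eps Heps.
  pose proof (sparse_diff_digits n D Hn HD Hcases) as Hsparse. clear Hcases.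
  apply attractor_expansion in Hz as (dig & Hdig & Hz).
  apply attractor_expansion in Hz' as (dig' & Hdig' & Hz').
  set (N := length (bounded_list (n * n) D)).
  assert (HinD : forall d, D d -> In d (bounded_list (n * n) D)).
  { intros d Hd. apply bounded_list_spec. auto. }
  assert (HN : (1 <= N)%nat).
  { unfold N. specialize (HinD _ (Hdig O)).
    destruct (bounded_list (n * n) D); [contradiction|simpl; lia]. }
  assert (LN : 0 <= ln (INR N)).
  { rewrite <- ln_1. apply ln_le; [lra|]. now apply (le_INR 1). }
  pose proof (Cmod_base_gt2 n Hn) as Hb.
  assert (HL : 0 < ln (Cmod (base n))) by (rewrite <- ln_1; apply ln_increasing; lra).
  assert (Es : s = ln (INR N) / ln (Cmod (base n))).
  { apply (has_box_dim_unique (attractor n D)); [assumption|].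
    now apply attractor_box_dim with (d0 := dig O). }
  (* If [s = 0] then [lambda = 0], and [t = 0] is taken. *)
  assert (Ht : exists t, 0 <= t <= 1 /\ lambda = t * s).
  { destruct (Req_dec s 0) as [->|Hs0]; [exists 0; lra|].
    exists (lambda / s). split; [|field; assumption].
    split; [apply Rle_mult_inv_pos; lra|].
    apply (Rmult_le_reg_r s); [lra|]. unfold Rdiv. rewrite Rmult_assoc, Rinv_l; lra. }
  destruct Ht as (t & Ht & ->).
  destruct (list_argmax Z.of_nat _ _ (HinD _ (Hdig O))) as (dmax & Hmax & Hdmax).
  destruct (list_argmax (fun d => - Z.of_nat d)%Z _ _ (HinD _ (Hdig O))) as (dmin & Hmin & Hdmin).
  apply bounded_list_spec in Hmax as [Hmaxle Hmax], Hmin as [_ Hmin].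
  set (alpha_dig := fun k => (Z.of_nat (dig k) - Z.of_nat (dig' k))%Z).
  assert (Halpha : expansion n alpha_dig alpha).
  { replace alpha with (z - (z - alpha))%C by ring. now apply expansion_minus. }
  (* Changing digits from [J] on moves the sum by at most [2 n^2 |b|^-J]; the added 1 makes the
     comparison with [eps] strict. *)
  destruct (pow_exceeds (Cmod (base n)) ((2 * INR (n * n) + 1) / eps)) as [J HJ]; [lra|].
  set (delta := fun k => if lt_dec k J then alpha_dig k
    else if Z.eq_dec (up (INR (S k) * t)) (up (INR k * t))
      then (Z.of_nat dmax - Z.of_nat dmin)%Z else 0%Z).
  assert (Hdiff_bound : forall x, diffset D x -> (Z.abs x <= Z.of_nat (n * n))%Z).
  { intros x (d & d' & Hd & Hd' & ->). apply HD in Hd, Hd'. lia. }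
  assert (Hadiff : forall k, diffset D (alpha_dig k)).
  { intro k. exists (dig k), (dig' k). auto. }
  assert (Hdelta : forall k, diffset D (delta k)).
  { intro k. unfold delta. destruct (lt_dec k J); [apply Hadiff|].
    destruct (Z.eq_dec _ _); [now exists dmax, dmin|].
    exists dmax, dmax. repeat split; [assumption|assumption|lia]. }
  destruct (expansion_exists n delta (Z.of_nat (n * n)) Hn) as [beta Hbeta];
    [intro; now apply Hdiff_bound|].
  exists beta. split.
  - pose proof (expansion_close n J delta alpha_dig (Z.of_nat (n * n)) beta alpha Hn) as Hclose.
    rewrite <- INR_IZR_INZ in Hclose.
    assert (HbJ : 0 < Cmod (base n) ^ J) by (apply pow_lt; lra).
    apply (Rmult_lt_reg_r (Cmod (base n) ^ J)); [assumption|].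
    apply (Rmult_le_compat_l eps) in HJ; [|lra].
    replace (eps * ((2 * INR (n * n) + 1) / eps)) with (2 * INR (n * n) + 1) in HJ by (field; lra).
    eapply Rle_lt_trans; [|eapply Rlt_le_trans; [|exact HJ]];
      [apply Hclose; auto|lra].
    intros k Hk. unfold delta. destruct (lt_dec k J); [reflexivity|contradiction].
  - pose proof (fun z => inter_set_digit_set n D delta beta z Hn HD Hsparse Hdelta Hbeta) as Hset.
    assert (Hle : forall k d, In d (common_digits n D (delta k)) -> (d <= n * n)%nat).
    { intros k d Hd. now apply bounded_list_spec in Hd. }
    assert (Hinh : forall k, exists d, In d (common_digits n D (delta k))).
    { intro k. now apply common_digits_inhabited. }
    split.
    (* Every position has a common digit, so [C(beta)] is nonempty and [beta] lies in [F]. *)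
    + destruct (digit_set_inhabited n (fun k => common_digits n D (delta k))) as [w Hw];
        [assumption|assumption|assumption|].
      exists w. now apply Hset.
    + apply (has_box_dim_ext _ _ _ Hset).
      replace (t * s) with (t * ln (INR N) / ln (Cmod (base n)))
        by (rewrite Es; field; lra).
      apply digit_set_box_dim with (B := (INR J + 2) * ln (INR N));
        [assumption|assumption|intro; apply bounded_list_NoDup|assumption| |].
      * apply Rmult_le_pos; lra.
      * apply prefixes_growth; [assumption|assumption| | |].
        -- intro k. split; [|apply length_common_digits_le].
           destruct (Hinh k) as [d Hd].
           destruct (common_digits n D (delta k)); [contradiction|simpl; lia].
        -- intros k HJk E. unfold delta. destruct (lt_dec k J); [lia|].
           destruct (Z.eq_dec _ _); [|contradiction].
           apply length_common_digits_extreme; auto.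
           intros d Hd. specialize (Hdmax d (HinD d Hd)). specialize (Hdmin d (HinD d Hd)). lia.
        -- intros k HJk E. unfold delta. destruct (lt_dec k J); [lia|].
           destruct (Z.eq_dec _ _); [contradiction|]. apply length_common_digits_zero.
Qed.
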